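(* There exist universal constants $c_0>0$ and $C>0$ (independent of $\mathbb{F},q,n,r$ and the design) such that the following holds. Let $\mathbb{F}\in\{\mathbb{R},\mathbb{C}\}$, $q\ge2$, and let $\{O_i\}_{i=1}^n$ be a complete design of self-adjoint $q\times q$ matrices over $\mathbb{F}$. If the number $r$ of measurements per observable satisfies $r\ge q\,c_0\,\mathrm{Tr}[(\mathfrak{D}^*\mathfrak{D})^{-1}]$, then $$\inf_{\hat\rho}\ \sup_{\rho}\ \mathbb{E}\big[\|\hat\rho-\rho\|_2^2\,\big|\,\rho\big]\ \ge\ C\,\frac{q^2}{nr},$$ where the supremum is over all $q\times q$ density matrices $\rho$ over $\mathbb{F}$ and the infimum is over all estimators $\hat\rho\in\mathbb{F}^{q\times q}$, i.e. (measurable) functions of the data $(Y_{ij})_{1\le i\le n,1\le j\le r}$.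
   Context: $\mathbb{F}^{q\times q}_{sa}$ is the real vector space of self-adjoint (symmetric/Hermitian) $q\times q$ matrices with Frobenius inner product; $\|\cdot\|_2$ is the Frobenius norm. A density matrix is a non-negative definite trace-one element of $\mathbb{F}^{q\times q}_{sa}$. Each $O_i=\sum_{k=1}^{q_i}\lambda_{ik}\Pi_{ik}$ (distinct eigenvalues, orthogonal eigenprojections, $m_{ik}=\mathrm{Tr}[\Pi_{ik}]$, $q_i\ge2$). $\mathfrak{D}^*\mathfrak{D}:\mathbb{F}^{q\times q}_{sa}\to\mathbb{F}^{q\times q}_{sa}$ is the linear map $S\mapsto\sum_{i=1}^n\sum_{k=1}^{q_i}\frac{\mathrm{Tr}[S\Pi_{ik}]}{m_{ik}}\Pi_{ik}$, which is invertible for a complete design; $\mathrm{Tr}[(\mathfrak{D}^*\mathfrak{D})^{-1}]$ is the trace of its inverse as a linear map on the real vector space $\mathbb{F}^{q\times q}_{sa}$. The collection is a complete design if for every traceless $\Delta\in\mathbb{F}^{q\times q}_{sa}$: $\mathrm{Tr}[\Delta\Pi_{ik}]=0$ for all $i,k$ if and only if $\Delta=0$. Data: given $\rho$, the outcomes $Y_{ij}$ ($1\le i\le n$, $1\le j\le r$) are independent with $\mathbb{P}(Y_{ij}=\lambda_{ik}\mid\rho)=\mathrm{Tr}[\rho\Pi_{ik}]$. *)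

(* Defs.v *)
From HB Require Import structures.
From mathcomp Require Import all_boot all_order all_algebra.
From mathcomp Require Import complex.
From mathcomp Require Import classical_sets reals ereal.

Set Implicit Arguments.
Unset Strict Implicit.
Unset Printing Implicit Defensive.

Import Order.TTheory GRing.Theory Num.Theory.

Local Open Scope ring_scope.

(* The two base fields are treated uniformly: [scalar R K] is [R] or [R[i]],
   with its conjugation, its real part and the embedding of [R]. *)
Inductive base_field := RealBase | ComplexBase.

Definition scalar (R : realType) (K : base_field) : numFieldType :=
  match K with RealBase => R | ComplexBase => R[i] end.

Definition sconj (R : realType) (K : base_field) : scalar R K -> scalar R K :=
  match K with RealBase => id | ComplexBase => @conjc R end.

Definition sre (R : realType) (K : base_field) : scalar R K -> R :=
  match K with RealBase => id | ComplexBase => @complex.Re R end.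

Definition ofreal (R : realType) (K : base_field) : R -> scalar R K :=
  match K with RealBase => id | ComplexBase => @real_complex R end.
Arguments ofreal {R} K _.
Arguments sconj {R K} _.
Arguments sre {R K} _.

Section ScalarTheory.
Variables (R : realType) (K : base_field).
Local Notation F := (scalar R K).

Fact ofreal_is_zmod_morphism : zmod_morphism (@ofreal R K).
Proof. by case: K => //= x y; rewrite -?rmorphB -?raddfB. Qed.
Fact ofreal_is_monoid_morphism : monoid_morphism (@ofreal R K).
Proof. by case: K; split => //= x y; rewrite rmorphM. Qed.
HB.instance Definition _ :=
  GRing.isZmodMorphism.Build R F (@ofreal R K) ofreal_is_zmod_morphism.
HB.instance Definition _ :=
  GRing.isMonoidMorphism.Build R F (@ofreal R K) ofreal_is_monoid_morphism.

Fact sconj_is_zmod_morphism : zmod_morphism (@sconj R K).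
Proof. by case: K => //= x y; rewrite -?rmorphB -?raddfB. Qed.
Fact sconj_is_monoid_morphism : monoid_morphism (@sconj R K).
Proof.
split; case: K; [by []|exact: rmorph1|by []|].
exact: (rmorphM (@conjc R)).
Qed.
HB.instance Definition _ :=
  GRing.isZmodMorphism.Build F F (@sconj R K) sconj_is_zmod_morphism.
HB.instance Definition _ :=
  GRing.isMonoidMorphism.Build F F (@sconj R K) sconj_is_monoid_morphism.

Fact sre_is_zmod_morphism : zmod_morphism (@sre R K).
Proof. by case: K => //= x y; rewrite -?rmorphB -?raddfB. Qed.
HB.instance Definition _ :=
  GRing.isZmodMorphism.Build F R (@sre R K) sre_is_zmod_morphism.

Lemma sconjK : involutive (@sconj R K).
Proof. by case: K => // x /=; rewrite conjcK. Qed.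

Lemma sconj_ofreal (x : R) : sconj (ofreal K x) = ofreal K x.
Proof. by case: K => //; exact: conjc_real. Qed.

Lemma sre_ofreal (x : R) : sre (ofreal K x) = x.
Proof. by case: K. Qed.

Lemma sconj_fixed (x : F) : sconj x = x -> x = ofreal K (sre x).
Proof.
case: K x => // -[a b] [] /eqP; rewrite eq_sym -subr_eq0 opprK -mulr2n.
by rewrite mulrn_eq0 /= => /eqP->.
Qed.

Lemma sre_ofrealM (a : R) (x : F) : sre (ofreal K a * x) = a * sre x.
Proof. by case: K x => // -[b c] /=; rewrite mul0r subr0. Qed.

End ScalarTheory.

Section Matrices.
Variables (R : realType) (K : base_field).
Local Notation F := (scalar R K).

Definition adjoint m n (A : 'M[F]_(m, n)) : 'M[F]_(n, m) :=
  map_mx (@sconj R K) A^T.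

Lemma adjointM m n p (A : 'M[F]_(m, n)) (B : 'M[F]_(n, p)) :
  adjoint (A *m B) = adjoint B *m adjoint A.
Proof. by rewrite /adjoint trmx_mul map_mxM. Qed.

Lemma adjointZ m n c (A : 'M[F]_(m, n)) :
  adjoint (c *: A) = sconj c *: adjoint A.
Proof. by apply/matrixP => i j; rewrite !mxE rmorphM. Qed.

Lemma adjoint_sum m n (I : finType) (A : I -> 'M[F]_(m, n)) :
  adjoint (\sum_i A i) = \sum_i adjoint (A i).
Proof.
apply/matrixP => i j; rewrite !(mxE, summxE) rmorph_sum.
by apply: eq_bigr => k _; rewrite !mxE.
Qed.

Lemma sconj_tr m (A : 'M[F]_m) : sconj (\tr A) = \tr (adjoint A).
Proof. by rewrite /adjoint trace_map_mx mxtrace_tr. Qed.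

Definition selfadjoint q (A : 'M[F]_q) : Prop := adjoint A = A.

Definition frobenius_sq m n (A : 'M[F]_(m, n)) : R :=
  \sum_i \sum_j sre (`|A i j| ^+ 2).

(* In the order of [F], [0 <= z] entails that [z] is real. *)
Definition nonneg_definite q (A : 'M[F]_q) : Prop :=
  selfadjoint A /\ forall v : 'cV[F]_q, 0 <= (adjoint v *m A *m v) 0 0.

Definition density q (rho : 'M[F]_q) : Prop :=
  nonneg_definite rho /\ \tr rho = 1.

End Matrices.

(* ['M[F]_q] seen as a vector space over [R] instead of [F]. *)
Definition realmx (R : realType) (K : base_field) (q : nat) : Type :=
  'M[scalar R K]_q.

Section RealMatrixSpace.
Variables (R : realType) (K : base_field) (q : nat).
Local Notation F := (scalar R K).
Local Notation V := (realmx R K q).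

HB.instance Definition _ := GRing.Zmodule.copy V 'M[F]_q.

Definition realmx_scale (a : R) (A : V) : V := ofreal K a *: (A : 'M[F]_q).

Fact realmx_scaleA a b A :
  realmx_scale a (realmx_scale b A) = realmx_scale (a * b) A.
Proof. by rewrite /realmx_scale scalerA rmorphM. Qed.
Fact realmx_scale1 : left_id 1 realmx_scale.
Proof. by move=> A; rewrite /realmx_scale rmorph1 scale1r. Qed.
Fact realmx_scaleDr : right_distributive realmx_scale +%R.
Proof. by move=> a A B; rewrite /realmx_scale scalerDr. Qed.
Fact realmx_scaleDl A : {morph realmx_scale^~ A : a b / a + b}.
Proof. by move=> a b; rewrite /realmx_scale rmorphD scalerDl. Qed.
HB.instance Definition _ := GRing.Zmodule_isLmodule.Build R V
  realmx_scaleA realmx_scale1 realmx_scaleDr realmx_scaleDl.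

Lemma realmxZE (a : R) (A : V) i j :
  ((a *: A : V) : 'M[F]_q) i j = ofreal K a * (A : 'M[F]_q) i j.
Proof. by rewrite mxE. Qed.



Definition realmx_dim : nat :=
  match K with RealBase => q * q | ComplexBase => q * q + q * q end.

End RealMatrixSpace.

Fact realmx_vect_iso (R : realType) (K : base_field) (q : nat) :
  Vector.axiom (realmx_dim K q) (realmx R K q).
Proof.
case: K.
- exists (fun A : 'M[R]_q => mxvec A); first by move=> a A B; rewrite linearP.
  exact: (Bijective mxvecK vec_mxK).
- exists (fun A : 'M[R[i]]_q => row_mx (mxvec (map_mx (@complex.Re R) A))
                                    (mxvec (map_mx (@complex.Im R) A))).
    move=> a A B; rewrite scale_row_mx add_row_mx -!linearP.
    congr (row_mx (mxvec _) (mxvec _)); apply/matrixP => i j; rewrite !mxE.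
      by case: (A i j) (B i j) => [x y] [z t] /=; rewrite mul0r subr0.
    by case: (A i j) (B i j) => [x y] [z t] /=; rewrite mul0r addr0.
  exists (fun v : 'rV[R]_(q * q + q * q) => \matrix_(i, j)
    (vec_mx (lsubmx v) i j +i* vec_mx (rsubmx v) i j)%C) => [A|v].
    rewrite row_mxKl row_mxKr !mxvecK; apply/matrixP => i j; rewrite !mxE.
    by case: (A i j).
  rewrite -[RHS]hsubmxK; congr row_mx; apply: (canLR vec_mxK);
  by apply/matrixP => i j; rewrite !mxE.
Qed.

Section SelfadjointSpace.
Variables (R : realType) (K : base_field) (q : nat).
Local Notation F := (scalar R K).
Local Notation V := (realmx R K q).

HB.instance Definition _ := Lmodule_hasFinDim.Build R V (@realmx_vect_iso R K q).

Definition skew_part (A : V) : V := A - adjoint (A : 'M[F]_q).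

Fact skew_part_is_linear : linear skew_part.
Proof.
move=> a A B; apply/matrixP => i j.
rewrite !mxE rmorphD rmorphM /= sconj_ofreal.
by rewrite mulrBr opprD addrACA.
Qed.
HB.instance Definition _ :=
  GRing.isLinear.Build R V V _ skew_part skew_part_is_linear.

(* The self-adjoint matrices as a subspace over the reals; [subvs_of saspace]
   is the corresponding vector space. *)
Definition saspace : {vspace V} := lker (linfun skew_part).

Lemma saspaceP (A : V) : reflect (selfadjoint (A : 'M[F]_q)) (A \in saspace).
Proof.
rewrite memv_ker lfunE /= subr_eq0 eq_sym; exact: eqP.
Qed.

End SelfadjointSpace.

Arguments saspace R K q : clear implicits.

Notation sa_type R K q := (subvs_of (saspace R K q)).

Definition lftrace (R : fieldType) (V : vectType R) (f : 'End(V)) : R :=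
  \tr (passmx.mxof (vbasis {:V}) (vbasis {:V}) f).

Lemma lftrace_basis (R : fieldType) (V : vectType R)
    (e : (\dim {:V}).-tuple V) (f : 'End(V)) :
  basis_of {:V} e -> lftrace f = \tr (passmx.mxof e e f).
Proof.
move=> eb; have vb := vbasisP (fullv : {vspace V}).
have comp11 (g : 'End(V)) : (\1 \o g)%VF = g.
  by apply/lfunP => u; rewrite comp_lfunE id_lfunE.
have comp1r (g : 'End(V)) : (g \o \1)%VF = g.
  by apply/lfunP => u; rewrite comp_lfunE id_lfunE.
rewrite /lftrace -[in LHS](comp1r f) (passmx.mxof_comp _ _ eb).
by rewrite mxtrace_mulC -(passmx.mxof_comp _ _ vb) comp11.
Qed.

Section Observables.
Variables (R : realType) (K : base_field) (q : nat).
Local Notation F := (scalar R K).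

(* A self-adjoint matrix together with its spectral decomposition
   O = \sum_k lambda_k Pi_k. *)
Record observable := Observable {
  obs_mx : 'M[F]_q;
  obs_size : nat;
  eigval : 'I_obs_size -> R;
  eigproj : 'I_obs_size -> 'M[F]_q;
  obs_selfadjoint : selfadjoint obs_mx;
  obs_size_ge2 : (2 <= obs_size)%N;
  eigval_inj : injective eigval;
  eigproj_neq0 : forall k, eigproj k != 0;
  eigproj_selfadjoint : forall k, selfadjoint (eigproj k);
  eigproj_orth : forall k l,
    eigproj k *m eigproj l = if k == l then eigproj k else 0;
  eigproj_sum1 : \sum_k eigproj k = 1%:M;
  obs_spectral : obs_mx = \sum_k ofreal K (eigval k) *: eigproj k
}.

End Observables.

Arguments observable R K q : clear implicits.

Section Designs.
Variables (R : realType) (K : base_field) (q n : nat).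
Local Notation F := (scalar R K).
Variable O : 'I_n -> observable R K q.

Definition complete_design : Prop :=
  forall Delta : 'M[F]_q, selfadjoint Delta -> \tr Delta = 0 ->
    (forall i (k : 'I_(obs_size (O i))), \tr (Delta *m eigproj k) = 0)
    <-> Delta = 0.

Definition DstarD_fun (S : 'M[F]_q) : 'M[F]_q :=
  \sum_(i < n) \sum_(k < obs_size (O i))
    (\tr (S *m eigproj k) / \tr (eigproj k)) *: eigproj k.

Lemma DstarD_fun_sa (S : 'M[F]_q) :
  selfadjoint S -> selfadjoint (DstarD_fun S).
Proof.
move=> sS; rewrite /selfadjoint /DstarD_fun adjoint_sum.
apply: eq_bigr => i _; rewrite adjoint_sum; apply: eq_bigr => k _.
have sP := eigproj_selfadjoint k.
rewrite adjointZ sP; congr (_ *: _).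
by rewrite rmorphM fmorphV /= !sconj_tr adjointM sS sP mxtrace_mulC.
Qed.

(* [DstarD_fun] preserves self-adjointness, so the projection [vsproj] only
   repackages its values as elements of [sa_type R K q]. *)
Definition DstarD_sa (S : sa_type R K q) : sa_type R K q :=
  vsproj (saspace R K q) (DstarD_fun (vsval S) : realmx R K q).

Fact DstarD_sa_is_linear : linear DstarD_sa.
Proof.
move=> a S T; rewrite /DstarD_sa -linearP; congr vsproj.
rewrite /DstarD_fun scaler_sumr -big_split; apply: eq_bigr => i _.
rewrite scaler_sumr -big_split; apply: eq_bigr => k _.
apply/matrixP => x y; rewrite !mxE linearP /=.
rewrite mulmxDl mxtraceD -scalemxAl mxtraceZ.
by rewrite !mulrDl !mulrA.
Qed.
HB.instance Definition _ := GRing.isLinear.Build R (sa_type R K q)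
  (sa_type R K q) _ DstarD_sa DstarD_sa_is_linear.

Definition DstarD : 'End(sa_type R K q) := linfun DstarD_sa.

Lemma DstarDE S : vsval (DstarD S) = DstarD_fun (vsval S) :> 'M[F]_q.
Proof.
rewrite /DstarD lfunE /= vsprojK //.
by apply/saspaceP/DstarD_fun_sa/saspaceP/subvsP.
Qed.

Variable r : nat.

Definition outcome : finType :=
  {dffun forall p : 'I_n * 'I_r, 'I_(obs_size (O p.1))}.

(* The Y_ij are independent, so their joint law is the product of the laws
   P(Y_ij = lambda_ik) = Tr[rho Pi_ik]. *)
Definition outcome_prob (rho : 'M[F]_q) (w : outcome) : R :=
  \prod_(p : 'I_n * 'I_r) sre (\tr (rho *m eigproj (w p))).

Definition data_of (w : outcome) : 'M[R]_(n, r) :=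
  \matrix_(i, j) eigval (w (i, j)).

(* The data take finitely many values, so the expectation is a finite sum and
   every function of the data agrees with a measurable one on its range. *)
Definition estimator := 'M[R]_(n, r) -> 'M[F]_q.

Definition risk (est : estimator) (rho : 'M[F]_q) : R :=
  \sum_(w : outcome) outcome_prob rho w * frobenius_sq (est (data_of w) - rho).

Definition minimax_risk : \bar R :=
  ereal_inf [set ereal_sup [set (risk est rho)%:E | rho in @density R K q]
            | est in [set: estimator]].

End Designs.

(* Main.v *)
(* Put A = D*D and let m_ik = Tr Pi_ik.  For t >= 0, summing the inequality
   <y, A y> >= 0 with y = A^-1 v - t v over a Parseval frame of the self-adjoint
   matrices gives Tr A^-1 >= 2 t Tr 1 - t^2 Tr A, where Tr 1 >= q^2/2 and
   Tr A = sum_i q_i <= n q.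
   With t = q/(2n) this yields Tr A^-1 >= q^3/(4n), so the hypothesis on r forces
   n r >= q^4/4 (for c0 = 1).  Nothing more about A is needed.

   The lower bound is Assouad's lemma for the hypercube of densities
   rho_eps = I/q + Delta_eps, where Delta_eps is real symmetric with zero diagonal
   and entries d eps_ab = +-d above it, d^2 = 1/(64 n r).  Since q d <= 1/(2q),
   rho_eps >= I/(2q) by diagonal dominance, hence every outcome has probability
   at least m_ik/(2q).  Flipping eps_ab moves the probability of the outcome (i,k)
   by 4 d |Re (Pi_ik)_ab|, so the Hellinger affinity of the two laws of the data is
   at least 1 - 4 q d^2 r sum_ik (Re (Pi_ik)_ab)^2 / m_ik.  Because
   sum_{a<b} (Re (Pi_ik)_ab)^2 <= m_ik, the affinities are bounded below on average
   over the q(q-1)/2 >= q^2/4 coordinates, each of which then contributes a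
   constant multiple of d^2 to the risk. *)

From HB Require Import structures.
Require Import Defs.
From mathcomp Require Import all_boot all_order all_algebra.
From mathcomp Require Import complex.
From mathcomp Require Import classical_sets reals ereal.
From mathcomp Require Import ring lra.

Set Implicit Arguments.
Unset Strict Implicit.
Unset Printing Implicit Defensive.

Import Order.TTheory GRing.Theory Num.Theory.

Local Open Scope ring_scope.

(** * Real parts, conjugates and moduli over either base field *)

Lemma sre_ge0 (R : realType) (K : base_field) (x : Defs.scalar R K) :
  0 <= x -> 0 <= sre x.
Proof. by case: K x => //= x; rewrite lecE => /andP[]. Qed.

Lemma ofreal_ge0 (R : realType) (K : base_field) (a : R) :
  0 <= a -> 0 <= ofreal K a.
Proof. by case: K => //= a0; rewrite lecE /= eqxx. Qed.

Lemma sqr_norm_sconj (R : realType) (K : base_field) (x : Defs.scalar R K) :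
  `|x| ^+ 2 = sconj x * x.
Proof.
case: K x => /= x; first by rewrite real_normK ?num_real.
by rewrite sqr_normc mulrC.
Qed.

Lemma sre_sconj (R : realType) (K : base_field) (x : Defs.scalar R K) :
  sre (sconj x) = sre x.
Proof. by case: K x => // -[]. Qed.

Lemma sre_sqr_norm_ge0 (R : realType) (K : base_field) (x : Defs.scalar R K) :
  0 <= sre (`|x| ^+ 2).
Proof. by apply: sre_ge0; rewrite exprn_ge0. Qed.

Lemma sqr_sre_le_norm (R : realType) (K : base_field) (x : Defs.scalar R K) :
  sre x ^+ 2 <= sre (`|x| ^+ 2).
Proof.
rewrite sqr_norm_sconj; case: K x => // -[a b] /=.
by rewrite mulNr opprK expr2 lerDl -expr2 sqr_ge0.
Qed.

(** * Traces of endomorphisms computed from frames *)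

Lemma lftrace_coord (R : fieldType) (V : vectType R) (f : 'End(V)) :
  lftrace f = \sum_i coord (vbasis {:V}) i (f (vbasis {:V})`_i).
Proof.
apply: eq_bigr => i _; rewrite mxE /= mxE; congr (coord _ _ (f _)).
exact: passmx.vecof_delta.
Qed.

(** Expanding the basis vectors in the frame, and each [f (v i)] in the basis, leads to the same
    double sum. The family [v] may be linearly dependent. *)
Lemma lftrace_frame (R : fieldType) (V : vectType R) (I : finType)
    (v : I -> V) (phi : I -> {linear V -> R^o}) (f : 'End(V)) :
  (forall x, x = \sum_i phi i x *: v i) ->
  lftrace f = \sum_i phi i (f (v i)).
Proof.
move=> fr; rewrite lftrace_coord.
transitivity (\sum_(j < \dim {:V}) \sum_i
    phi i (vbasis {:V})`_j * coord (vbasis {:V}) j (f (v i))).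
  apply: eq_bigr => j _; rewrite {1}[(vbasis _)`_j]fr !linear_sum.
  by apply: eq_bigr => i _; rewrite !linearZ.
rewrite exchange_big; apply: eq_bigr => i _ /=.
rewrite [in RHS](coord_vbasis (memvf (f (v i)))) linear_sum.
by apply: eq_bigr => j _; rewrite linearZ /= mulrC.
Qed.

(** * The real inner product and a Parseval frame of the self-adjoint matrices *)

Section Frame.
Variables (R : realType) (K : base_field) (q : nat).
Local Notation F := (Defs.scalar R K).
Local Notation V := (sa_type R K q).

Definition inner (S T : 'M[F]_q) : R := sre (\tr (S *m T)).

Lemma innerC S T : inner S T = inner T S.
Proof. by rewrite /inner mxtrace_mulC. Qed.

Lemma inner_suml (I : finType) (S : I -> 'M[F]_q) T :
  inner (\sum_i S i) T = \sum_i inner (S i) T.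
Proof. by rewrite /inner mulmx_suml (raddf_sum (@mxtrace _ q)) raddf_sum. Qed.

Lemma innerZl a S T : inner (ofreal K a *: S) T = a * inner S T.
Proof. by rewrite /inner -scalemxAl mxtraceZ sre_ofrealM. Qed.

Lemma innerDl S S' T : inner (S + S') T = inner S T + inner S' T.
Proof. by rewrite /inner mulmxDl !raddfD. Qed.

Lemma innerBl S S' T : inner (S - S') T = inner S T - inner S' T.
Proof. by rewrite /inner mulmxBl !raddfB. Qed.

Lemma inner_self S : selfadjoint S -> inner S S = frobenius_sq S.
Proof.
move=> sS; rewrite /inner raddf_sum; apply: eq_bigr => i _ /=.
rewrite mxE raddf_sum; apply: eq_bigr => j _ /=.
by rewrite sqr_norm_sconj -{2}sS !mxE mulrC.
Qed.

Lemma frobenius_sq_ge0 m n (S : 'M[F]_(m, n)) : 0 <= frobenius_sq S.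
Proof. by do 2!apply: sumr_ge0 => ? _; apply: sre_sqr_norm_ge0. Qed.

(** The value 0 over the reals makes [sim] and the antisymmetric frame elements vanish there, so one
    computation covers both fields; over the complex numbers [sim] is the imaginary part. *)
Definition iunit : F :=
  match K with RealBase => 0 | ComplexBase => ('i)%C end.

Definition sim (x : F) : R := sre (- (iunit * x)).

Lemma sreim x : x = ofreal K (sre x) + iunit * ofreal K (sim x).
Proof.
rewrite /sim /iunit; case: K x => /= [x|[a b]]; first by rewrite mul0r addr0.
by apply/eqP; rewrite eq_complex /= ; apply/andP; split; apply/eqP; ring.
Qed.

Lemma sim_sconj x : sim (sconj x) = - sim x.
Proof.
rewrite /sim /iunit; case: K x => /= [x|[a b] /=]; last by ring.
by rewrite mul0r oppr0 oppr0.
Qed.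

Lemma trmx_delta_mul (S : 'M[F]_q) i j : \tr (S *m delta_mx i j) = S j i.
Proof.
rewrite /mxtrace (bigD1 j) //= mxE (bigD1 i) //= mxE !eqxx mulr1 big1 ?addr0.
  rewrite big1 ?addr0 // => k nk; rewrite mxE big1 // => l _.
  by rewrite mxE (negPf nk) andbF mulr0.
by move=> l nl; rewrite mxE (negPf nl) mulr0.
Qed.

Lemma sre_half_conj x : sre ((2^-1 : F) * (sconj x + x)) = sre x.
Proof.
have -> : 2^-1 = ofreal K 2^-1 :> F by rewrite fmorphV rmorph_nat.
by rewrite sre_ofrealM raddfD /= sre_sconj; field.
Qed.

Lemma sre_half_iunit x : sre ((2^-1 : F) * iunit * (sconj x - x)) = sim x.
Proof.
have -> : 2^-1 = ofreal K 2^-1 :> F by rewrite fmorphV rmorph_nat.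
rewrite -mulrA sre_ofrealM /sim /iunit; case: K x => /= [x|[a b] /=].
  by rewrite !mul0r oppr0 mulr0.
by field.
Qed.

(** The cases [e = 1] and [e = -1] produce the symmetric and antisymmetric halves of the frame
    expansion. *)
Lemma sum_sym_delta (X : 'M[F]_q) (c e : F) :
  \sum_i \sum_j X i j *: (c *: (delta_mx i j + e *: delta_mx j i))
  = c *: (X + e *: X^T).
Proof.
have XT : X^T = \sum_i \sum_j X i j *: delta_mx j i.
  rewrite {1}(matrix_sum_delta X) (raddf_sum (@trmx _ q q)).
  apply: eq_bigr => i _; rewrite (raddf_sum (@trmx _ q q)).
  by apply: eq_bigr => j _; apply/matrixP => k l; rewrite !mxE andbC.
transitivity (c *: (\sum_i \sum_j X i j *: delta_mx i j + e *: X^T)); last first.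
  by rewrite -matrix_sum_delta.
rewrite XT [e *: _]scaler_sumr.
rewrite -big_split scaler_sumr; apply: eq_bigr => i _.
rewrite [e *: _]scaler_sumr -big_split scaler_sumr.
apply: eq_bigr => j _; rewrite /= !scalerDr !scalerA.
by congr (_ *: _ + _ *: _); ring.
Qed.

(* The orthogonal projections onto the self-adjoint matrices of the orthonormal
   basis [E_ij], [i E_ij] of all matrices; they form a Parseval frame. *)
Definition sa_frame_mx (x : bool * ('I_q * 'I_q)) : 'M[F]_q :=
  let: (b, (i, j)) := x in
  if b then 2^-1 *: (delta_mx i j + delta_mx j i)
  else (2^-1 * iunit) *: (delta_mx i j - delta_mx j i).

Lemma inner_sa_frame S x : selfadjoint S ->
  inner S (sa_frame_mx x) = (if x.1 then sre else sim) (S x.2.1 x.2.2).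
Proof.
move=> sS; case: x => [b [i j]] /=.
have Sji : S j i = sconj (S i j) by rewrite -{1}sS !mxE.
case: b; rewrite /inner -scalemxAr mxtraceZ ?mulmxBr ?mulmxDr.
  by rewrite mxtraceD !trmx_delta_mul Sji sre_half_conj.
by rewrite raddfB /= !trmx_delta_mul Sji sre_half_iunit.
Qed.

Lemma selfadjoint_sa_frame x : selfadjoint (sa_frame_mx x).
Proof.
case: x => [b [i j]]; rewrite /selfadjoint; apply/matrixP => k l.
have c2 : sconj (2^-1 : F) = 2^-1 by rewrite fmorphV rmorph_nat.
have ci : sconj iunit = - iunit.
  rewrite /iunit; case: K => /=; rewrite ?oppr0 //.
  by apply/eqP; rewrite eq_complex /= oppr0 !eqxx.
case: b; rewrite !mxE rmorphM ?rmorphM ?rmorphD ?rmorphB /= c2 ?ci !rmorph_nat.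
  by rewrite addrC ![(l == _) && _]andbC.
by rewrite ![(l == _) && _]andbC; ring.
Qed.

Definition sa_frame x : V := vsproj (saspace R K q) (sa_frame_mx x : Defs.realmx R K q).

Lemma vsval_sa_frame x : vsval (sa_frame x) = sa_frame_mx x.
Proof. by rewrite vsprojK //; apply/saspaceP/selfadjoint_sa_frame. Qed.

(** Linearity in the last argument and the codomain [R^o] give [sa_inner T] the shape of the
    coefficient functionals in [lftrace_frame]. *)
Definition sa_inner (T S : V) : R^o := inner (vsval S) (vsval T).

Fact sa_inner_linear T : linear (sa_inner T).
Proof.
by move=> a S S'; rewrite /sa_inner linearP /= innerDl; congr (_ + _);
  apply: innerZl.
Qed.
HB.instance Definition _ T :=
  GRing.isLinear.Build R V R^o _ (sa_inner T) (sa_inner_linear T).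

Lemma sa_innerC S T : sa_inner S T = sa_inner T S.
Proof. exact: innerC. Qed.

Lemma sa_innerBZ (t : R) (S S' T : V) :
  sa_inner T (S - t *: S') = sa_inner T S - t * sa_inner T S'.
Proof. by rewrite linearB linearZ. Qed.

Lemma sa_inner_self_ge0 S : 0 <= sa_inner S S.
Proof.
rewrite /sa_inner inner_self ?frobenius_sq_ge0 //.
exact/saspaceP/subvsP.
Qed.

Lemma sa_frameE S : S = \sum_x sa_inner (sa_frame x) S *: sa_frame x.
Proof.
apply: val_inj; rewrite /= linear_sum /=.
have sS : selfadjoint (vsval S : 'M[F]_q) by exact/saspaceP/subvsP.
transitivity (\sum_x ofreal K ((if x.1 then sre else sim) (vsval S x.2.1 x.2.2))
    *: sa_frame_mx x); last first.
  apply: eq_bigr => x _.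
  by rewrite vsval_sa_frame /sa_inner vsval_sa_frame inner_sa_frame.
pose G b p := ofreal K ((if b then sre else sim) (vsval S p.1 p.2))
  *: sa_frame_mx (b, p).
transitivity (\sum_x G x.1 x.2); last by apply: eq_bigr => -[b [i j]].
have -> : \sum_x G x.1 x.2 = \sum_p G true p + \sum_p G false p.
  by rewrite -(pair_bigA _ G) big_bool.
have PB b : \sum_p G b p = \sum_i \sum_j G b (i, j).
  by rewrite pair_bigA; apply: eq_bigr => -[].
rewrite !PB {PB}/G /=.
have Y c (X : 'M[F]_q) : \sum_i \sum_j X i j *: (c *: (delta_mx i j - delta_mx j i))
    = c *: (X - X^T).
  rewrite -[- X^T]scaleN1r -sum_sym_delta.
  by do 2!apply: eq_bigr => ? _; rewrite scaleN1r.
have X c (X : 'M[F]_q) : \sum_i \sum_j X i j *: (c *: (delta_mx i j + delta_mx j i))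
    = c *: (X + X^T).
  rewrite -[X^T]scale1r -sum_sym_delta.
  by do 2!apply: eq_bigr => ? _; rewrite scale1r.
(* Self-adjointness makes the entrywise real part symmetric and the imaginary part antisymmetric, so
   (anti)symmetrising them changes nothing. *)
have E : (vsval S : 'M[F]_q) = 2^-1 *: (map_mx (ofreal K \o sre) (vsval S : 'M[F]_q)
    + (map_mx (ofreal K \o sre) (vsval S : 'M[F]_q))^T)
  + (2^-1 * iunit) *: (map_mx (ofreal K \o sim) (vsval S : 'M[F]_q)
    - (map_mx (ofreal K \o sim) (vsval S : 'M[F]_q))^T).
  apply/matrixP => k l; rewrite !mxE /=.
  have -> : (vsval S : 'M[F]_q) l k = sconj ((vsval S : 'M[F]_q) k l).
    by rewrite -{1}sS !mxE.
  rewrite sre_sconj sim_sconj rmorphN /= {1}[vsval S k l]sreim; by field.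
rewrite -X -Y in E; apply: (etrans E).
by congr (_ + _); do 2!apply: eq_bigr => ? _; rewrite mxE.
Qed.

Lemma sa_inner_frame S T :
  sa_inner T S = \sum_x sa_inner (sa_frame x) S * sa_inner (sa_frame x) T.
Proof.
rewrite {1}[S]sa_frameE linear_sum; apply: eq_bigr => x _ /=.
by rewrite linearZ (sa_innerC (sa_frame x) T).
Qed.

(** The sum is the trace of the identity, that is, the real dimension. The symmetric elements alone
    suffice: each of the [q^2] index pairs contributes at least 1/2. *)
Lemma sum_sa_frame_norm : q%:R ^+ 2 / 2 <= \sum_x sa_inner (sa_frame x) (sa_frame x).
Proof.
pose G b p := sa_inner (sa_frame (b, p)) (sa_frame (b, p)).
have -> : \sum_x sa_inner (sa_frame x) (sa_frame x)
    = \sum_p G true p + \sum_p G false p.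
  by rewrite -(big_bool _ (fun b => \sum_p G b p)) pair_bigA; apply: eq_bigr => -[].
rewrite -[leLHS]addr0 lerD ?sumr_ge0 // => [|? _]; last exact: sa_inner_self_ge0.
have -> : q%:R ^+ 2 / 2 = \sum_(p : 'I_q * 'I_q) (2^-1 : R).
  by rewrite sumr_const card_prod card_ord -[RHS]mulr_natl natrM expr2.
apply: ler_sum => -[i j] _.
rewrite /G /sa_inner !vsval_sa_frame inner_sa_frame; last exact: selfadjoint_sa_frame.
have -> : sa_frame_mx (true, (i, j)) i j = ofreal K (2^-1 * (1 + (i == j)%:R)) :> F.
  rewrite !mxE !eqxx [j == i]eq_sym rmorphM fmorphV rmorph_nat.
  rewrite rmorphD rmorph_nat !andbb; congr (_ * (_ + _)).
  by apply: esym; exact: rmorph1.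
by rewrite /= sre_ofreal ler_peMr ?invr_ge0 // lerDl.
Qed.

End Frame.

(** * Eigenprojections, the quadratic form of D*D and the trace of its inverse *)

Lemma mxtrace_idempotent (F : fieldType) (q : nat) (P : 'M[F]_q) :
  P *m P = P -> \tr P = (\rank P)%:R.
Proof.
move=> PP; have /row_fullP[C' C'C] := col_base_full P.
have /row_freeP[B' BB'] := row_base_free P.
(* For a full-rank factorisation [P = C B], cancelling [C] and [B] in [C B C B = C B] leaves
   [B C = 1], of size the rank; then Tr P = Tr (B C). *)
have BC1 r (C : 'M[F]_(q, r)) B D E : C *m B *m (C *m B) = C *m B ->
    D *m C = 1%:M -> B *m E = 1%:M -> B *m C = 1%:M.
  move=> CB DC BE; have := congr1 (fun M => D *m M *m E) CB.
  by rewrite !mulmxA DC !mul1mx BE -mulmxA BE mulmx1.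
have {}BC1 : row_base P *m col_base P = 1%:M.
  by apply: BC1 C'C BB'; rewrite mulmx_base.
by rewrite -{1}(mulmx_base P) mxtrace_mulC BC1 mxtrace1.
Qed.

Section Design.
Variables (R : realType) (K : base_field) (q : nat).
Local Notation F := (Defs.scalar R K).
Local Notation V := (sa_type R K q).

Lemma eigproj_idem (o : observable R K q) (k : 'I_(obs_size o)) :
  eigproj k *m eigproj k = eigproj k :> 'M[F]_q.
Proof. by rewrite eigproj_orth eqxx. Qed.

Lemma mxtrace_eigproj (o : observable R K q) (k : 'I_(obs_size o)) :
  \tr (eigproj k) = (\rank (eigproj k))%:R.
Proof. exact/mxtrace_idempotent/eigproj_idem. Qed.

Lemma eigproj_rank_gt0 (o : observable R K q) (k : 'I_(obs_size o)) :
  (0 < \rank (eigproj k))%N.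
Proof. by rewrite lt0n mxrank_eq0 eigproj_neq0. Qed.

Lemma sum_eigproj_rank (o : observable R K q) :
  (\sum_(k < obs_size o) \rank (eigproj k))%N = q.
Proof.
apply/eqP; rewrite -(eqr_nat F) natr_sum -[X in _ == X]mxtrace1.
rewrite -(eigproj_sum1 o) (raddf_sum (@mxtrace _ q)); apply/eqP.
by apply: eq_bigr => k _; symmetry; exact: mxtrace_eigproj.
Qed.

(** The ranks of the eigenprojections are positive and add up to [q]. *)
Lemma obs_size_le (o : observable R K q) : (obs_size o <= q)%N.
Proof.
rewrite -[leqRHS](sum_eigproj_rank o) -{1}[obs_size o]card_ord -sum1_card.
by apply: leq_sum => k _; exact: eigproj_rank_gt0.
Qed.

Lemma mxtrace_sa (S T : 'M[F]_q) :
  selfadjoint S -> selfadjoint T -> \tr (S *m T) = ofreal K (inner S T).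
Proof.
move=> sS sT; apply: sconj_fixed.
by rewrite sconj_tr adjointM sS sT mxtrace_mulC.
Qed.

Lemma inner_eigproj (o : observable R K q) (k : 'I_(obs_size o)) :
  inner (eigproj k) (eigproj k) = (\rank (eigproj k))%:R.
Proof.
rewrite /inner eigproj_idem mxtrace_eigproj.
by rewrite -[RHS](sre_ofreal K) rmorph_nat.
Qed.

Variables (n : nat) (O : 'I_n -> observable R K q).

Lemma sa_inner_DstarD (S T : V) : sa_inner T (DstarD O S) =
  \sum_(i < n) \sum_(k < obs_size (O i))
    inner (vsval S) (eigproj k) * inner (vsval T) (eigproj k)
    / (\rank (eigproj k))%:R.
Proof.
have sS : selfadjoint (vsval S : 'M[F]_q) by exact/saspaceP/subvsP.
rewrite /sa_inner DstarDE /DstarD_fun inner_suml; apply: eq_bigr => i _.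
rewrite inner_suml; apply: eq_bigr => k _.
rewrite (mxtrace_sa sS (eigproj_selfadjoint k)) mxtrace_eigproj.
have -> : (\rank (eigproj k))%:R = ofreal K (\rank (eigproj k))%:R :> F.
  by rewrite rmorph_nat.
by rewrite -fmorphV -rmorphM innerZl (innerC (eigproj k)) mulrAC.
Qed.

Lemma DstarD_selfadjoint (S T : V) :
  sa_inner T (DstarD O S) = sa_inner S (DstarD O T).
Proof.
rewrite !sa_inner_DstarD; do 2!apply: eq_bigr => ? _.
by rewrite [X in X / _]mulrC.
Qed.

Lemma DstarD_ge0 (S : V) : 0 <= sa_inner S (DstarD O S).
Proof.
rewrite sa_inner_DstarD; do 2!apply: sumr_ge0 => ? _.
by rewrite -expr2 mulr_ge0 ?sqr_ge0 ?invr_ge0.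
Qed.

(** By Parseval, each pair (i, k) contributes the squared norm of its projection divided by its
    rank, which is 1; an observable has at most [q] projections. *)
Lemma sum_frame_DstarD_le :
  \sum_x sa_inner (sa_frame R K x) (DstarD O (sa_frame R K x)) <= n%:R * q%:R :> R.
Proof.
under eq_bigr do rewrite sa_inner_DstarD.
rewrite exchange_big /= -natrM -[n in leRHS]card_ord -sum_nat_const natr_sum.
apply: ler_sum => i _; rewrite exchange_big /=.
apply: (@le_trans _ _ (\sum_(k < obs_size (O i)) 1)); last first.
  by rewrite sumr_const card_ord ler_nat obs_size_le.
apply: ler_sum => k _; rewrite -mulr_suml.
pose P : V := vsproj (saspace R K q) (eigproj k : Defs.realmx R K q).
have PE : vsval P = eigproj k.
  by rewrite vsprojK //; apply/saspaceP; exact: eigproj_selfadjoint.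
have := sa_inner_frame P P; rewrite {1}/sa_inner PE inner_eigproj.
rewrite /sa_inner PE => E.
rewrite (eq_bigr _ (fun x _ => congr2 *%R (innerC _ _) (innerC _ _))) -E.
by rewrite divff // pnatr_eq0 -lt0n eigproj_rank_gt0.
Qed.

(** On the kernel the quadratic form is a vanishing sum of nonnegative terms, so all traces against
    projections vanish. Since [n > 0], the projections of one observable sum to 1, so the trace
    vanishes too and completeness applies. *)
Lemma DstarD_inj : (0 < n)%N -> complete_design O -> lker (DstarD O) == 0%VS.
Proof.
move=> n0 cO; apply/lker0P => S T /eqP; rewrite -subr_eq0 -linearB /=.
set D := S - T => /eqP D0; apply/eqP; rewrite -subr_eq0 -/D.
have sD : selfadjoint (vsval D : 'M[F]_q) by exact/saspaceP/subvsP.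
have := sa_inner_DstarD D D; rewrite D0 linear0 => /esym E.
have ge0 i (k : 'I_(obs_size (O i))) : 0 <= inner (vsval D) (eigproj k)
    * inner (vsval D) (eigproj k) / (\rank (eigproj k))%:R.
  by rewrite -expr2 mulr_ge0 ?sqr_ge0 ?invr_ge0.
have tr0 i (k : 'I_(obs_size (O i))) : \tr ((vsval D : 'M[F]_q) *m eigproj k) = 0.
  rewrite mxtrace_sa //; last exact: eigproj_selfadjoint.
  have := psumr_eq0P (fun i _ => sumr_ge0 _ (fun k _ => ge0 i k)) E
    (erefl : true) (i := i).
  move=> /psumr_eq0P - /(_ (fun k _ => ge0 i k)) /(_ k isT) /eqP.
  rewrite mulf_eq0 invr_eq0 pnatr_eq0 mulf_eq0 orbb.
  by rewrite -[(_ == 0)%N]negbK -lt0n eigproj_rank_gt0 orbF => /eqP->; rewrite rmorph0.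
apply/eqP; apply: val_inj; apply/(cO _ sD) => //.
have -> : (vsval D : 'M[F]_q)
    = \sum_k (vsval D : 'M[F]_q) *m @eigproj _ _ _ (O (Ordinal n0)) k.
  by rewrite -mulmx_sumr eigproj_sum1 mulmx1.
by rewrite (raddf_sum (@mxtrace _ q)) big1 // => k _; exact: tr0.
Qed.

Lemma lftrace_invDstarD_quadratic (t : R) : 0 <= t ->
  (0 < n)%N -> complete_design O ->
  t * q%:R ^+ 2 - t ^+ 2 * (n%:R * q%:R) <= lftrace (DstarD O)^-1%VF.
Proof.
move=> t0 n0 cO; have AV := lker0_lfunVK (DstarD_inj n0 cO).
rewrite (lftrace_frame (phi := fun x => sa_inner (sa_frame R K x)) _
  (@sa_frameE R K q)).
set A := DstarD O; set B := (A^-1)%VF.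
have pt x : 0 <= sa_inner x (B x) - 2 * t * sa_inner x x + t ^+ 2 * sa_inner x (A x).
  have := DstarD_ge0 (B x - t *: x); set y := B x - t *: x.
  have -> : DstarD O y = x - t *: A x by rewrite linearB linearZ /= AV.
  have -> z : sa_inner y (x - t *: z) = sa_inner x (B x) - t * sa_inner x x
      - t * (sa_inner z (B x) - t * sa_inner z x).
    rewrite sa_innerBZ [sa_inner y x]sa_innerC [sa_inner y z]sa_innerC.
    by rewrite !sa_innerBZ.
  (* Symmetry of [A] and [A B = 1] turn the cross term <A x, B x> into <x, x>. *)
  rewrite [sa_inner (A x) (B x)]sa_innerC (DstarD_selfadjoint x (B x)) AV.
  rewrite [sa_inner (A x) x]sa_innerC; set u := sa_inner x x; nra.
pose v := @sa_frame R K q.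
have H : 0 <= \sum_x sa_inner (v x) (B (v x)) - 2 * t * \sum_x sa_inner (v x) (v x)
    + t ^+ 2 * \sum_x sa_inner (v x) (A (v x)).
  rewrite !mulr_sumr -sumrB -big_split; apply: sumr_ge0 => x _; exact: pt.
have := ler_wpM2l t0 (@sum_sa_frame_norm R K q).
have := ler_wpM2l (sqr_ge0 t) sum_frame_DstarD_le.
rewrite -/A -/v; lra.
Qed.

Lemma lftrace_invDstarD_ge : (0 < n)%N -> complete_design O ->
  q%:R ^+ 3 / (4 * n%:R) <= lftrace (DstarD O)^-1%VF.
Proof.
move=> n0 cO; have nR : 0 < n%:R :> R by rewrite ltr0n.
(* This [t] maximises [t q^2 - t^2 n q]. *)
apply: le_trans (lftrace_invDstarD_quadratic (t := q%:R / (2 * n%:R)) _ n0 cO);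
  last first.
  by rewrite divr_ge0 // mulr_ge0.
rewrite le_eqVlt; apply/orP; left; apply/eqP; field.
by rewrite lt0r_neq0.
Qed.

End Design.

(** * The hypercube of densities and its outcome probabilities *)

Section Hypotheses.
Variables (R : realType) (K : base_field) (q : nat).
Local Notation F := (Defs.scalar R K).

(** The quadratic form at [v] is [(a - q d) |v|^2] plus the sum over i, j of [(d + D i j)/4 |v i + v
    j|^2 + (d - D i j)/4 |v i - v j|^2], where all weights are nonnegative. *)
Lemma nonneg_definite_diag_dominant (a d : R) (D : 'M[R]_q) :
  D^T = D -> (forall i j, `|D i j| <= d) -> q%:R * d <= a ->
  nonneg_definite ((ofreal K a)%:M + map_mx (ofreal K) D).
Proof.
move=> DT Dd qda; split.
  rewrite /selfadjoint; apply/matrixP => i j.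
  rewrite !mxE rmorphD rmorphMn /= !sconj_ofreal eq_sym.
  by rewrite -[in RHS]DT mxE.
move=> v; pose c i j : F := sconj (v i 0) * v j 0.
have -> : (adjoint v *m ((ofreal K a)%:M + map_mx (ofreal K) D) *m v) 0 0
    = ofreal K a * \sum_i c i i + \sum_i \sum_j ofreal K (D i j) * c i j.
  rewrite mulmxDr mulmxDl mxE; congr (_ + _).
    rewrite mul_mx_scalar -scalemxAl mxE; congr (_ * _); rewrite mxE.
    by apply: eq_bigr => i _; rewrite !mxE.
  rewrite mxE exchange_big; apply: eq_bigr => j _ /=.
  rewrite mxE mulr_suml; apply: eq_bigr => i _; rewrite !mxE /c.
  by rewrite mulrA [_ * ofreal _ _]mulrC.
have sym : \sum_i \sum_j ofreal K (D i j) * c i j =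
    \sum_i \sum_j ofreal K (D i j) * c j i.
  rewrite exchange_big; do 2!apply: eq_bigr => ? _.
  by rewrite -[in LHS]DT mxE.
have -> : ofreal K a * \sum_i c i i + \sum_i \sum_j ofreal K (D i j) * c i j
  = ofreal K (a - q%:R * d) * \sum_i c i i +
    \sum_i \sum_j (ofreal K ((d + D i j) / 4) * `|v i 0 + v j 0| ^+ 2
                 + ofreal K ((d - D i j) / 4) * `|v i 0 - v j 0| ^+ 2).
  have -> : \sum_i \sum_j (ofreal K ((d + D i j) / 4) * `|v i 0 + v j 0| ^+ 2
                 + ofreal K ((d - D i j) / 4) * `|v i 0 - v j 0| ^+ 2)
    = 2^-1 * \sum_i \sum_j (ofreal K d * c i i + ofreal K d * c j j
         + (ofreal K (D i j) * c i j + ofreal K (D i j) * c j i)).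
    rewrite mulr_sumr; apply: eq_bigr => i _; rewrite mulr_sumr.
    apply: eq_bigr => j _; rewrite !sqr_norm_sconj !rmorphM !fmorphV !rmorph_nat.
    by rewrite !rmorphB !rmorphD /c /=; field.
  have -> : \sum_i \sum_j (ofreal K d * c i i + ofreal K d * c j j
         + (ofreal K (D i j) * c i j + ofreal K (D i j) * c j i))
    = 2 * (q%:R * ofreal K d * \sum_i c i i)
      + 2 * \sum_i \sum_j ofreal K (D i j) * c i j.
    have E1 : \sum_(i < q) \sum_(j < q) ofreal K d * c i i
        = q%:R * ofreal K d * \sum_i c i i.
      rewrite mulr_sumr; apply: eq_bigr => i _.
      by rewrite sumr_const card_ord -[LHS]mulr_natl mulrA.
    have E2 : \sum_(i < q) \sum_(j < q) ofreal K d * c j j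
        = q%:R * ofreal K d * \sum_i c i i by rewrite exchange_big.
    under eq_bigr do rewrite !big_split /=.
    by rewrite !big_split /= E1 E2 -sym; ring.
  by rewrite rmorphB rmorphM rmorph_nat /=; field.
have cii i : c i i = `|v i 0| ^+ 2 by rewrite sqr_norm_sconj.
rewrite addr_ge0 //.
  rewrite mulr_ge0 ?ofreal_ge0 ?subr_ge0 // sumr_ge0 // => i _.
  by rewrite cii exprn_ge0.
apply: sumr_ge0 => i _; apply: sumr_ge0 => j _.
have := Dd i j; rewrite ler_norml => /andP[D1 D2].
rewrite addr_ge0 // mulr_ge0 ?exprn_ge0 // ofreal_ge0 // divr_ge0 //; lra.
Qed.

(** Tr (M P) = Tr (P M P) is the sum of the form of [M] over the columns of [P]. *)
Lemma inner_nonneg_proj (M P : 'M[F]_q) :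
  nonneg_definite M -> selfadjoint P -> P *m P = P -> 0 <= inner M P.
Proof.
move=> [sM M0] sP PP; apply: sre_ge0.
rewrite -PP mulmxA mxtrace_mulC; apply: sumr_ge0 => j _.
have := M0 (col j P).
have -> : adjoint (col j P) = row j (adjoint P).
  by apply/matrixP => a b; rewrite !mxE.
rewrite sP -mulmxA !mxE => H; apply: le_trans H _.
rewrite le_eqVlt; apply/orP; left; apply/eqP.
apply: eq_bigr => k _; rewrite !mxE; congr (_ * _).
by apply: eq_bigr => l _; rewrite !mxE.
Qed.

(** Entries (i, j) and (j, i) read the same sign, stored at the increasing pair, which gives
    symmetry; the zero diagonal preserves the trace. *)
Definition pert_mx (d : R) (eps : {ffun 'I_q * 'I_q -> bool}) : 'M[R]_q :=
  \matrix_(i, j) if i == j then 0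
    else d * (-1) ^+ eps (if (i < j)%N then (i, j) else (j, i)).

Lemma pert_mx_sym d eps : (pert_mx d eps)^T = pert_mx d eps.
Proof.
apply/matrixP => i j; rewrite !mxE eq_sym; case: eqP => // /eqP nij.
by case: ltngtP => // /val_inj eij; rewrite eij eqxx in nij.
Qed.

Lemma pert_mx_le d eps i j : 0 <= d -> `|pert_mx d eps i j| <= d.
Proof.
move=> d0; rewrite mxE; case: eqP => _; first by rewrite normr0.
by rewrite normrM normrX normrN1 expr1n mulr1 ger0_norm.
Qed.

Definition hyp_density d eps : 'M[F]_q :=
  (ofreal K q%:R^-1)%:M + map_mx (ofreal K) (pert_mx d eps).

(** Half of the diagonal [1/q] dominates the perturbation; the other half is the margin that keeps
    outcome probabilities away from 0. *)
Lemma hyp_density_ge (d : R) eps :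
  0 <= d -> (0 < q)%N -> q%:R * d <= (2 * q%:R)^-1 ->
  nonneg_definite (hyp_density d eps - (ofreal K (2 * q%:R)^-1)%:M).
Proof.
move=> d0 q0 qd; rewrite /hyp_density addrAC -raddfB /= -rmorphB.
have -> : q%:R^-1 - (2 * q%:R)^-1 = (2 * q%:R)^-1 :> R.
  by field; rewrite pnatr_eq0 -lt0n.
apply: nonneg_definite_diag_dominant qd; first exact: pert_mx_sym.
by move=> i j; apply: pert_mx_le.
Qed.

Lemma mxtrace_hyp_density d eps : (0 < q)%N -> \tr (hyp_density d eps) = 1.
Proof.
move=> q0; rewrite mxtraceD mxtrace_scalar /mxtrace [X in _ + X]big1.
  rewrite addr0 fmorphV rmorph_nat -[LHS]mulr_natl divff //.
  by rewrite pnatr_eq0 -lt0n.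
by move=> i _; rewrite !mxE eqxx rmorph0.
Qed.

Lemma density_hyp d eps :
  0 <= d -> (0 < q)%N -> q%:R * d <= (2 * q%:R)^-1 -> density (hyp_density d eps).
Proof.
move=> d0 q0 qd; split; last exact: mxtrace_hyp_density.
apply: nonneg_definite_diag_dominant (pert_mx_sym _ _) _ (le_trans qd _).
  by move=> i j; apply: pert_mx_le.
by rewrite lef_pV2 ?posrE ?mulr_gt0 ?ltr0n // ler_peMl // ler1n.
Qed.

Definition hyp_prob (o : observable R K q) d eps (k : 'I_(obs_size o)) : R :=
  inner (hyp_density d eps) (eigproj k).

Lemma sum_hyp_prob (o : observable R K q) d eps : (0 < q)%N ->
  \sum_k hyp_prob (o := o) d eps k = 1.
Proof.
move=> q0; rewrite /hyp_prob /inner -raddf_sum -(raddf_sum (@mxtrace _ q)).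
rewrite -mulmx_sumr eigproj_sum1 mulmx1.
transitivity (sre (1 : F)); first by congr sre; exact: mxtrace_hyp_density.
by rewrite -(sre_ofreal K 1) rmorph1.
Qed.

Lemma inner_scalar a (o : observable R K q) (k : 'I_(obs_size o)) :
  inner (ofreal K a)%:M (eigproj k) = a * (\rank (eigproj k))%:R.
Proof.
rewrite /inner mul_scalar_mx mxtraceZ sre_ofrealM mxtrace_eigproj.
by rewrite -[X in _ = _ * X](sre_ofreal K) rmorph_nat.
Qed.

Lemma hyp_prob_ge (o : observable R K q) d eps (k : 'I_(obs_size o)) :
  0 <= d -> (0 < q)%N -> q%:R * d <= (2 * q%:R)^-1 ->
  (\rank (eigproj k))%:R / (2 * q%:R) <= hyp_prob d eps k.
Proof.
move=> d0 q0 qd; rewrite mulrC -inner_scalar -subr_ge0 -innerBl.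
apply: inner_nonneg_proj; first exact: hyp_density_ge.
  exact: eigproj_selfadjoint.
exact: eigproj_idem.
Qed.

Definition flip (p : 'I_q * 'I_q) (eps : {ffun 'I_q * 'I_q -> bool}) :
  {ffun 'I_q * 'I_q -> bool} := [ffun x => (x == p) (+) eps x].

Lemma flipK p : involutive (flip p).
Proof. by move=> eps; apply/ffunP => x; rewrite !ffunE addbA addbb. Qed.

Lemma pert_mx_flip d eps (i j : 'I_q) : (i < j)%N ->
  pert_mx d eps - pert_mx d (flip (i, j) eps)
  = (2 * d * (-1) ^+ eps (i, j)) *: (delta_mx i j + delta_mx j i).
Proof.
move=> ij; apply/matrixP => a b; rewrite !mxE ffunE.
have nij : i != j by rewrite neq_ltn ij.
case: (eqVneq a b) => [<-|nab].
  rewrite subr0 (_ : (a == i) && (a == j) = false) 1?(_ : (a == j) && (a == i) = false).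
  - by rewrite addr0 mulr0.
  - by apply/negP => /andP[/eqP-> /eqP e]; rewrite e eqxx in nij.
  - by apply/negP => /andP[/eqP-> /eqP e]; rewrite e eqxx in nij.
case: (ltngtP a b) => [ab|ba|/val_inj e]; last by rewrite e eqxx in nab.
- rewrite [(a == j) && _](_ : _ = false); last first.
    by apply/negP => /andP[/eqP e1 /eqP e2]; move: ab; rewrite e1 e2 ltnNge ltnW.
  rewrite xpair_eqE addr0; case: andP => [[/eqP-> /eqP->]|_] /=.
    by rewrite signrN; ring.
  by rewrite subrr mulr0.
- rewrite [(a == i) && _](_ : _ = false); last first.
    by apply/negP => /andP[/eqP e1 /eqP e2]; move: ba; rewrite e1 e2 ltnNge ltnW.
  rewrite xpair_eqE add0r andbC; case: andP => [[/eqP-> /eqP->]|_] /=.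
    by rewrite signrN; ring.
  by rewrite subrr mulr0.
Qed.

(** Two mirror entries change by [2 d] each and meet conjugate entries of the projection, hence
    [4 d] times a real part, squared. *)
Lemma hyp_prob_flip (o : observable R K q) d eps (i j : 'I_q)
    (k : 'I_(obs_size o)) : (i < j)%N ->
  (hyp_prob d eps k - hyp_prob d (flip (i, j) eps) k) ^+ 2
  = 16 * d ^+ 2 * sre (eigproj k i j) ^+ 2.
Proof.
move=> ij; rewrite /hyp_prob -innerBl /hyp_density opprD addrACA subrr add0r.
rewrite -raddfB /= pert_mx_flip //.
have -> : map_mx (ofreal K)
      ((2 * d * (-1) ^+ eps (i, j)) *: (delta_mx i j + delta_mx j i))
    = ofreal K (2 * d * (-1) ^+ eps (i, j)) *: (delta_mx i j + delta_mx j i).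
  by apply/matrixP => a b; rewrite !mxE rmorphM rmorphD !rmorph_nat.
rewrite innerZl innerC /inner mulmxDr mxtraceD !trmx_delta_mul raddfD /=.
have -> : sre (eigproj k j i) = sre (eigproj k i j).
  by rewrite -[in LHS](eigproj_selfadjoint k) !mxE sre_sconj.
by rewrite !exprMn sqrr_sign mulr1; ring.
Qed.

(** The sum is bounded by the squared Frobenius norm of the projection, which equals its rank. *)
Lemma sum_sqr_sre_eigproj (o : observable R K q) (k : 'I_(obs_size o)) :
  \sum_(p : 'I_q * 'I_q | (p.1 < p.2)%N) sre (eigproj k p.1 p.2) ^+ 2
  <= (\rank (eigproj k))%:R.
Proof.
rewrite -inner_eigproj inner_self; last exact: eigproj_selfadjoint.
rewrite /frobenius_sq pair_bigA /=.
rewrite [X in _ <= X](bigID (fun p : 'I_q * 'I_q => (p.1 < p.2)%N)) /=.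
rewrite -[leLHS]addr0 lerD //.
  by apply: ler_sum => p _; apply: sqr_sre_le_norm.
by apply: sumr_ge0 => p _; apply: sre_sqr_norm_ge0.
Qed.

(** Splitting all pairs at the diagonal gives [q^2 = 2 N + q], and [q <= q^2 / 2] for [q >= 2]. *)
Lemma card_lt_pairs : (2 <= q)%N ->
  q%:R ^+ 2 / 4 <= \sum_(p : 'I_q * 'I_q | (p.1 < p.2)%N) (1 : R).
Proof.
move=> q2.
have sw : \sum_(p : 'I_q * 'I_q | (p.1 < p.2)%N) (1 : R)
    = \sum_(p : 'I_q * 'I_q | (p.2 < p.1)%N) 1.
  have swK : involutive (fun p : 'I_q * 'I_q => (p.2, p.1)) by case.
  by rewrite (reindex_inj (inv_inj swK)).
have dg : \sum_(p : 'I_q * 'I_q | p.1 == p.2) (1 : R) = q%:R.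
  rewrite (eq_bigl (fun p : 'I_q * 'I_q => xpredT p.1 && (p.1 == p.2))) //.
  rewrite -(pair_big_dep xpredT (fun i j => i == j) (fun _ _ => 1)) /=.
  under eq_bigr => i _ do rewrite (big_pred1 i) //.
  by rewrite sumr_const card_ord.
have : \sum_(p : 'I_q * 'I_q) (1 : R) = q%:R ^+ 2.
  by rewrite sumr_const card_prod card_ord natrM expr2.
rewrite (bigID (fun p : 'I_q * 'I_q => (p.1 < p.2)%N)) /=.
rewrite [X in _ + X](bigID (fun p : 'I_q * 'I_q => p.1 == p.2)) /=.
rewrite [X in _ + (X + _)](eq_bigl (fun p : 'I_q * 'I_q => p.1 == p.2)); last first.
  by move=> [a b] /=; case: eqP => [->|]; rewrite ?ltnn ?andbF.
rewrite [X in _ + (_ + X)](eq_bigl (fun p : 'I_q * 'I_q => (p.2 < p.1)%N)); last first.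
  by move=> [a b] /=; rewrite -(inj_eq val_inj) /=; case: ltngtP.
rewrite dg -sw; set N := \sum_(p | _) _.
have : 2 <= q%:R :> R by rewrite ler_nat.
nra.
Qed.

End Hypotheses.

(** * Product laws on finite spaces, Hellinger affinity and the two-point bound *)

Lemma prod_sum_dffun (R : comNzSemiRingType) (I : finType) (T : I -> finType)
    (f : forall i, T i -> R) :
  \sum_(w : {dffun forall i, T i}) \prod_i f i (w i) = \prod_i \sum_k f i k.
Proof.
pose P i := [ffun k : T i => f i k].
transitivity (\prod_i \sum_k P i k); last first.
  by apply: eq_bigr => i _; apply: eq_bigr => k _; rewrite ffunE.
(* Passing through [fprod] turns dependent functions into tagged choices, to which ordinary
   distributivity applies. *)
rewrite (reindex (@dffun_of_fprod I T)) /=; last first.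
  exact/onW_bij/dffun_of_fprod_bij.
transitivity (\sum_(t : fprod T) \prod_(i in I) P i (t i)).
  by apply: eq_bigr => w _; apply: eq_bigr => i _; rewrite !ffunE.
rewrite big_fprod; under [RHS]eq_bigr => i _ do rewrite (big_tag (fun i k => P i k)).
by rewrite bigA_distr_big_dep.
Qed.

Lemma sqrtr_prod (R : rcfType) (I : finType) (a : I -> R) :
  (forall i, 0 <= a i) -> Num.sqrt (\prod_i a i) = \prod_i Num.sqrt (a i).
Proof.
move=> a0; have s0 : 0 <= \prod_i Num.sqrt (a i).
  by apply: prodr_ge0 => i _; exact: sqrtr_ge0.
apply/eqP; rewrite -(@eqrXn2 _ 2) ?sqrtr_ge0 //.
rewrite sqr_sqrtr ?prodr_ge0 // -prodrXl; apply/eqP.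
by apply: eq_bigr => i _; rewrite sqr_sqrtr.
Qed.

(** Weierstrass' product inequality, by induction. The [b i] may be large: once their sum reaches 1,
    the left side is nonpositive. *)
Lemma prod_ge_one_sub_sum (R : realDomainType) (I : finType) (a b : I -> R) :
  (forall i, 0 <= a i) -> (forall i, 0 <= b i) -> (forall i, 1 - b i <= a i) ->
  1 - \sum_i b i <= \prod_i a i.
Proof.
move=> a0 b0 ab.
suff [] : 0 <= \prod_i a i /\ 0 <= \sum_i b i /\ 1 - \sum_i b i <= \prod_i a i.
  by move=> _ [].
elim/big_rec2: _ => [|i B A _ [A0 [B0 AB]]]; first by rewrite ler01 subr0.
have := a0 i; have := b0 i; have := ab i; move: (a i) (b i) => x y xy y0 x0.
split; first exact: mulr_ge0.
split; first exact: addr_ge0.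
have [h|h] := lerP 1 (y + B).
  by apply: (@le_trans _ _ 0); rewrite ?mulr_ge0 // subr_le0.
nra.
Qed.

(** With a, b the square roots, the gap between the means is [(a - b)^2 / 2 = (u - v)^2 / (2 (a +
    b)^2)], and [(a + b)^2 >= 4 l]. *)
Lemma sqrtr_mul_ge (R : rcfType) (u v l : R) : 0 < l -> l <= u -> l <= v ->
  (u + v) / 2 - (u - v) ^+ 2 / (8 * l) <= Num.sqrt u * Num.sqrt v.
Proof.
move=> l0 lu lv; have u0 : 0 <= u by lra.
have v0 : 0 <= v by lra.
have := sqr_sqrtr u0; have := sqrtr_ge0 u; move: (Num.sqrt u) => a a0 ua.
have := sqr_sqrtr v0; have := sqrtr_ge0 v; move: (Num.sqrt v) => b b0 vb.
subst u v; rewrite lerBlDr -lerBlDl ler_pdivlMr ?mulr_gt0 //.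
have ab : l <= a * b.
  rewrite -(@ler_pXn2r _ 2) ?nnegrE ?mulr_ge0 // ?(ltW l0) // exprMn.
  rewrite [l ^+ 2]expr2; apply: ler_pM => //; exact: ltW.
have lab : 4 * l <= (a + b) ^+ 2 by nra.
have -> : ((a ^+ 2 + b ^+ 2) / 2 - a * b) * (8 * l) = (a - b) ^+ 2 * (4 * l).
  by field.
have -> : (a ^+ 2 - b ^+ 2) ^+ 2 = (a - b) ^+ 2 * (a + b) ^+ 2 by ring.
by rewrite ler_wpM2l // sqr_ge0.
Qed.

Lemma affinity_ge (R : rcfType) (I : finType) (x y L : I -> R) :
  (forall k, 0 < L k) -> (forall k, L k <= x k) -> (forall k, L k <= y k) ->
  \sum_k x k = 1 -> \sum_k y k = 1 ->
  1 - \sum_k (x k - y k) ^+ 2 / (8 * L k)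
  <= \sum_k Num.sqrt (x k) * Num.sqrt (y k).
Proof.
move=> L0 Lx Ly sx sy.
have S1 : \sum_k (x k + y k) / 2 = 1.
  by rewrite -mulr_suml big_split /= sx sy; field.
rewrite -[X in X - _]S1 -sumrB; apply: ler_sum => k _.
exact: sqrtr_mul_ge.
Qed.

(* The quadratic form [(t - s)^2 p^2 + (t + s)^2 m^2 - s^2 (4 p m - p^2 - m^2)]
   is a sum of two squares. *)
Lemma two_point_ge (R : rcfType) (W : finType) (P Q t : W -> R) (s : R) :
  (forall w, 0 <= P w) -> (forall w, 0 <= Q w) ->
  \sum_w P w = 1 -> \sum_w Q w = 1 ->
  s ^+ 2 * (4 * \sum_w Num.sqrt (P w) * Num.sqrt (Q w) - 2)
  <= \sum_w P w * (t w - s) ^+ 2 + \sum_w Q w * (t w + s) ^+ 2.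
Proof.
move=> P0 Q0 sP sQ.
have -> : 2 = \sum_w (P w + Q w) by rewrite big_split /= sP sQ.
rewrite mulr_sumr -sumrB mulr_sumr -big_split; apply: ler_sum => w _ /=.
rewrite -{2 3}(sqr_sqrtr (P0 w)) -{2 3}(sqr_sqrtr (Q0 w)).
move: (Num.sqrt (P w)) (Num.sqrt (Q w)) (t w) => p m u; rewrite -subr_ge0.
have -> : p ^+ 2 * (u - s) ^+ 2 + m ^+ 2 * (u + s) ^+ 2
    - s ^+ 2 * (4 * (p * m) - (p ^+ 2 + m ^+ 2))
  = ((p - m) * u) ^+ 2 / 2 + 2 * ((p + m) * u / 2 - s * (p - m)) ^+ 2 by field.
by rewrite addr_ge0 // mulr_ge0 ?sqr_ge0 // invr_ge0.
Qed.

(** * Assouad's argument for a fixed estimator *)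

Section Assouad.
Variables (R : realType) (K : base_field) (q n r : nat).
Variable O : 'I_n -> observable R K q.
Local Notation F := (Defs.scalar R K).
Variable d : R.
Hypotheses (d_ge0 : 0 <= d) (q_ge2 : (2 <= q)%N) (d_le : q%:R * d <= (2 * q%:R)^-1).
Local Notation cube := ({ffun 'I_q * 'I_q -> bool}).

Let q_gt0 : (0 < q)%N. Proof. exact: leq_trans q_ge2. Qed.
Let qR_gt0 : 0 < q%:R :> R. Proof. by rewrite ltr0n. Qed.

Lemma rank_gt0R (o : observable R K q) (k : 'I_(obs_size o)) :
  0 < (\rank (eigproj k))%:R :> R.
Proof. by rewrite ltr0n eigproj_rank_gt0. Qed.

Lemma hyp_prob_ge0 (o : observable R K q) (eps : cube) (k : 'I_(obs_size o)) :
  0 <= hyp_prob d eps k.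
Proof.
apply: le_trans (@hyp_prob_ge R K q o d eps k d_ge0 q_gt0 d_le).
by rewrite divr_ge0 ?mulr_ge0.
Qed.

Definition law (eps : cube) (w : outcome O r) : R :=
  outcome_prob (hyp_density K d eps) w.

Lemma lawE eps w : law eps w = \prod_p hyp_prob d eps (w p).
Proof. by []. Qed.

Lemma law_ge0 eps w : 0 <= law eps w.
Proof. by rewrite lawE prodr_ge0 // => p _; exact: hyp_prob_ge0. Qed.

Lemma sum_law eps : \sum_w law eps w = 1.
Proof.
rewrite (prod_sum_dffun (fun p k => hyp_prob (o := O p.1) d eps k)).
by rewrite big1 // => p _; rewrite sum_hyp_prob.
Qed.

(** A bound for the affinity lost by flipping [p]: each term is the squared change
    [16 d^2 (Re Pi_p)^2] of a probability over 8 times its floor [m / (2 q)]. *)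
Definition separation (p : 'I_q * 'I_q) : R :=
  \sum_(x : 'I_n * 'I_r) \sum_(k < obs_size (O x.1))
    4 * q%:R * d ^+ 2 * sre (eigproj k p.1 p.2) ^+ 2 / (\rank (eigproj k))%:R.

(** The affinity of product laws is the product of the affinities, so Weierstrass' inequality
    reduces the bound to a single measurement. *)
Lemma law_affinity_ge (p : 'I_q * 'I_q) eps : (p.1 < p.2)%N ->
  1 - separation p <= \sum_w Num.sqrt (law eps w) * Num.sqrt (law (flip p eps) w).
Proof.
case: p => i j /= ij.
pose f (x : 'I_n * 'I_r) (k : 'I_(obs_size (O x.1))) :=
  Num.sqrt (hyp_prob d eps k) * Num.sqrt (hyp_prob d (flip (i, j) eps) k).
have sqrt_law e w : Num.sqrt (law e w) = \prod_x Num.sqrt (hyp_prob d e (w x)).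
  by rewrite lawE sqrtr_prod // => x; exact: hyp_prob_ge0.
under eq_bigr do rewrite !sqrt_law -big_split /=.
rewrite (prod_sum_dffun f) /separation /=; apply: prod_ge_one_sub_sum => x.
- by apply: sumr_ge0 => k _; rewrite mulr_ge0 ?sqrtr_ge0.
- apply: sumr_ge0 => k _.
  by rewrite divr_ge0 // mulr_ge0 ?sqr_ge0 // mulr_ge0 ?sqr_ge0 // mulr_ge0.
pose L (k : 'I_(obs_size (O x.1))) : R := (\rank (eigproj k))%:R / (2 * q%:R).
have L0 z : 0 < L z by rewrite divr_gt0 ?rank_gt0R ?mulr_gt0.
apply: le_trans (@affinity_ge R _ (hyp_prob d eps) (hyp_prob d (flip (i, j) eps)) L
  L0 _ _ _ _); rewrite ?sum_hyp_prob //.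
- rewrite lerD2l lerN2; apply: ler_sum => k _; rewrite hyp_prob_flip // le_eqVlt.
  apply/orP; left; apply/eqP; rewrite /L; field.
  by rewrite !lt0r_neq0 ?rank_gt0R.
- by move=> k; apply: hyp_prob_ge.
- by move=> k; apply: hyp_prob_ge.
Qed.

(** Summing over pairs first cancels the rank in each denominator; then at most [q] outcomes and
    [n r] measurements remain to be counted. *)
Lemma sum_separation_le :
  \sum_(p : 'I_q * 'I_q | (p.1 < p.2)%N) separation p
  <= 4 * (n%:R * r%:R) * q%:R ^+ 2 * d ^+ 2.
Proof.
rewrite exchange_big /=.
apply: (@le_trans _ _ (\sum_(x : 'I_n * 'I_r) 4 * q%:R ^+ 2 * d ^+ 2)); last first.
  rewrite sumr_const card_prod !card_ord -[leLHS]mulr_natl natrM.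
  by rewrite le_eqVlt; apply/orP; left; apply/eqP; ring.
apply: ler_sum => x _; rewrite exchange_big /=.
apply: (@le_trans _ _ (\sum_(k < obs_size (O x.1)) 4 * q%:R * d ^+ 2)); last first.
  rewrite sumr_const card_ord -[leLHS]mulr_natl.
  have -> : 4 * q%:R ^+ 2 * d ^+ 2 = q%:R * (4 * q%:R * d ^+ 2) by ring.
  by rewrite ler_wpM2r ?ler_nat ?obs_size_le // !mulr_ge0 ?sqr_ge0.
apply: ler_sum => k _; rewrite -mulr_suml -mulr_sumr ler_pdivrMr ?rank_gt0R //.
by rewrite ler_wpM2l ?sum_sqr_sre_eigproj // !mulr_ge0 ?sqr_ge0.
Qed.

Definition coord_risk (est : estimator R K q n r) (p : 'I_q * 'I_q) (eps : cube) : R :=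
  \sum_w law eps w * (sre (est (data_of w) p.1 p.2) - d * (-1) ^+ eps p) ^+ 2.

Lemma coord_risk_le est eps :
  \sum_(p : 'I_q * 'I_q | (p.1 < p.2)%N) coord_risk est p eps
  <= risk O est (hyp_density K d eps).
Proof.
rewrite exchange_big /risk /=; apply: ler_sum => w _.
rewrite -mulr_sumr ler_wpM2l ?law_ge0 // /frobenius_sq pair_bigA /=.
rewrite [X in _ <= X](bigID (fun p : 'I_q * 'I_q => (p.1 < p.2)%N)) /=.
rewrite -[leLHS]addr0 lerD //; last first.
  by apply: sumr_ge0 => p _; apply: sre_sqr_norm_ge0.
apply: ler_sum => -[i j] /= ij; apply: le_trans (sqr_sre_le_norm _).
have nij : i != j by rewrite neq_ltn ij.
rewrite !mxE (negPf nij) mulr0n add0r ij raddfB /= sre_ofreal.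
exact: lexx.
Qed.

(** A flip negates the target, so [two_point_ge] applies with [s = d (-1)^(eps p)], and [4 (1 -
    separation p) - 2 = 2 - 4 separation p]. *)
Lemma coord_risk_flip est (p : 'I_q * 'I_q) eps : (p.1 < p.2)%N ->
  d ^+ 2 * (2 - 4 * separation p)
  <= coord_risk est p eps + coord_risk est p (flip p eps).
Proof.
move=> p12; rewrite /coord_risk.
have -> : (-1) ^+ (flip p eps p) = - (-1) ^+ eps p :> R.
  by rewrite ffunE eqxx signrN.
under [X in _ <= _ + X]eq_bigr do rewrite mulrN opprK.
have := two_point_ge (fun w => sre (est (data_of w) p.1 p.2)) (d * (-1) ^+ eps p)
  (law_ge0 eps) (law_ge0 (flip p eps)) (sum_law _) (sum_law _).
apply: le_trans; rewrite exprMn sqrr_sign mulr1 ler_wpM2l ?sqr_ge0 //.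
have := law_affinity_ge eps p12; lra.
Qed.

(** The flip permutes the cube, so twice the sum is a sum over neighbouring vertices. *)
Lemma sum_coord_risk_ge est (p : 'I_q * 'I_q) : (p.1 < p.2)%N ->
  #|{: cube}|%:R * (d ^+ 2 * (1 - 2 * separation p)) <= \sum_eps coord_risk est p eps.
Proof.
move=> p12.
have E : \sum_eps coord_risk est p eps = \sum_eps coord_risk est p (flip p eps).
  exact: (reindex_inj (inv_inj (flipK p))).
rewrite -(@ler_pM2l _ 2) //.
have -> : 2 * \sum_eps coord_risk est p eps
    = \sum_eps (coord_risk est p eps + coord_risk est p (flip p eps)).
  by rewrite big_split /= -E; ring.
apply: (@le_trans _ _ (\sum_(eps : cube) d ^+ 2 * (2 - 4 * separation p))); last first.
  by apply: ler_sum => eps _; apply: coord_risk_flip.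
rewrite sumr_const -[leRHS]mulr_natl le_eqVlt; apply/orP; left; apply/eqP; ring.
Qed.

Lemma exists_risk_ge (est : estimator R K q n r) : exists eps : cube,
  d ^+ 2 * (q%:R ^+ 2 / 4 - 8 * (n%:R * r%:R) * q%:R ^+ 2 * d ^+ 2)
  <= risk O est (hyp_density K d eps).
Proof.
set B := d ^+ 2 * _.
have N0 : 0 < #|{: cube}|%:R :> R.
  by rewrite ltr0n; apply/card_gt0P; exists [ffun => true].
have H : #|{: cube}|%:R * B <= \sum_(eps : cube) risk O est (hyp_density K d eps).
  apply: (@le_trans _ _ (\sum_(eps : cube)
     \sum_(p : 'I_q * 'I_q | (p.1 < p.2)%N) coord_risk est p eps)); last first.
    by apply: ler_sum => eps _; apply: coord_risk_le.
  rewrite exchange_big /=.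
  apply: (@le_trans _ _ (\sum_(p : 'I_q * 'I_q | (p.1 < p.2)%N)
     #|{: cube}|%:R * (d ^+ 2 * (1 - 2 * separation p)))); last first.
    by apply: ler_sum => p; apply: sum_coord_risk_ge.
  rewrite -mulr_sumr -mulr_sumr sumrB -mulr_sumr ler_pM2l // ler_wpM2l ?sqr_ge0 //.
  have := card_lt_pairs R q_ge2; have := sum_separation_le; lra.
(* If every vertex had risk below [B], so would their average. *)
apply/existsP; apply: contraLR H => /existsPn h.
rewrite -ltNge mulr_natl -sumr_const; apply: ltr_sum => [|eps _].
  by apply/hasP; exists [ffun => true]; rewrite ?mem_index_enum.
by rewrite ltNge; apply/h.
Qed.

End Assouad.

(** * Passage to the minimax risk and choice of the constants *)

Lemma minimax_risk_ge (R : realType) (K : base_field) (q n r : nat)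
    (O : 'I_n -> observable R K q) (B : R) :
  (forall est : estimator R K q n r,
     exists2 rho, density rho & B <= risk O est rho) ->
  (B%:E <= minimax_risk O r)%E.
Proof.
move=> h; apply: le_ereal_inf_tmp => _ [est _ <-].
have [rho drho Brho] := h est.
apply: (@le_trans _ _ (risk O est rho)%:E); first by rewrite lee_fin.
by apply: ereal_sup_ubound; exists rho.
Qed.

Theorem theorem4p16 (R : realType) :
  exists c0 C : R, 0 < c0 /\ 0 < C /\
    forall (K : base_field) (q n r : nat) (O : 'I_n -> observable R K q),
      (2 <= q)%N ->
      complete_design O ->
      q%:R * c0 * lftrace (DstarD O)^-1%VF <= r%:R ->
      ((C * (q%:R ^+ 2 / (n%:R * r%:R)))%:E <= minimax_risk O r)%E.
Proof.
(* With [d^2 = 1/(64 n r)] the bound is [d^2 (q^2/4 - q^2/8) = q^2 / (512 n r)]. *)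
exists 1, 512%:R^-1; split=> //; split; first by rewrite invr_gt0.
move=> K q n r O q2 cO; rewrite mulr1 => Hr.
have q0 : 0 < q%:R :> R by rewrite ltr0n (leq_trans _ q2).
(* For [n = 0] the inverse of 0 is 0, so the claimed bound is 0; the cube degenerated to [d = 0]
   gives it. *)
have [n0|] := posnP n.
  subst n; rewrite mul0r invr0 !mulr0.
  apply: minimax_risk_ge => est.
  have d0 : q%:R * 0 <= (2 * q%:R)^-1 :> R.
    by rewrite mulr0 invr_ge0 mulr_ge0 // ltW.
  have [eps] := exists_risk_ge O (lexx 0) q2 d0 est.
  rewrite expr0n mul0r => Heps; exists (hyp_density K 0 eps) => //.
  by apply: density_hyp d0 => //; rewrite (leq_trans _ q2).
move=> n0; have nR : 0 < n%:R :> R by rewrite ltr0n.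
(* The chain is [q^4 / (4 n) <= q Tr A^-1 <= r]; it also forces [r > 0]. *)
have room : q%:R ^+ 4 <= 4 * (n%:R * r%:R) :> R.
  have := lftrace_invDstarD_ge n0 cO; rewrite ler_pdivrMr ?mulr_gt0 // => Ht.
  have := ler_wpM2l (ltW q0) Ht.
  have := ler_wpM2l (ltW (mulr_gt0 (ltr0n _ 4) nR)) Hr.
  rewrite !exprS expr0; lra.
have nr0 : 0 < n%:R * r%:R :> R by have := exprn_gt0 4 q0; lra.
have r0 : 0 < r%:R :> R by move: nr0; rewrite pmulr_rgt0.
(* The factor 64 makes the loss [8 n r q^2 d^2] equal to [q^2/8], half of the main term. *)
pose d : R := Num.sqrt (64 * (n%:R * r%:R))^-1.
have d2 : d ^+ 2 = (64 * (n%:R * r%:R))^-1.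
  by rewrite sqr_sqrtr // invr_ge0 mulr_ge0 // ltW.
(* Squared, this reads [4 q^4 <= 64 n r], which [room] yields with a factor 4 to spare. *)
have dle : q%:R * d <= (2 * q%:R)^-1.
  rewrite -(@ler_pXn2r _ 2) ?nnegrE ?mulr_ge0 ?sqrtr_ge0 ?invr_ge0 ?mulr_ge0 //;
    try exact: ltW.
  rewrite exprMn d2 exprVn ler_pdivrMr ?mulr_gt0 //.
  rewrite [leRHS]mulrC ler_pdivlMr ?exprn_gt0 ?mulr_gt0 //.
  have -> : q%:R ^+ 2 * (2 * q%:R) ^+ 2 = 4 * q%:R ^+ 4 :> R by ring.
  lra.
apply: minimax_risk_ge => est.
have [eps Heps] := exists_risk_ge O (sqrtr_ge0 _) q2 dle est.
exists (hyp_density K d eps).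
  by apply: density_hyp; rewrite ?sqrtr_ge0 // (leq_trans _ q2).
apply: le_trans Heps; rewrite d2 le_eqVlt; apply/orP; left; apply/eqP.
have n1 : n%:R != 0 :> R by rewrite lt0r_neq0.
have r1 : r%:R != 0 :> R by rewrite lt0r_neq0.
by field; rewrite n1 r1.
Qed.
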